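(* Let $(M,\Lambda,E)$ be a Jacobi manifold, let $a\in C^\infty(M,\mathbb{R})$ be a positive function, and let $(\Lambda_a,E_a)$ be the conformal change of the Jacobi structure $(\Lambda,E)$ by $a$, that is, the Jacobi structure $\Lambda_a=a\Lambda$, $E_a=\#_\Lambda(da)+aE$. Then $$H^k_{LJ}(M,\Lambda,E)\cong H^k_{LJ}(M,\Lambda_a,E_a)\quad\text{for all }k.$$
   Context: Manifolds are smooth and connected. $\mathcal V^k(M)$ and $\Omega^k(M)$ denote the spaces of $k$-vectors (skew-symmetric contravariant $k$-tensor fields) and $k$-forms on $M$ (zero for $k<0$). $[\,,\,]$ is the Schouten-Nijenhuis bracket, with the convention $[X,f]=X(f)$ for functions $f$, $[X,P]=\mathcal L_XP$ for vector fields $X$, $[P,Q]=(-1)^{pq}[Q,P]$ and $[P,Q\wedge R]=[P,Q]\wedge R+(-1)^{pq+q}Q\wedge[P,R]$ for $P\in\mathcal V^p(M)$, $Q\in\mathcal V^q(M)$. A Jacobi structure on $M$ is a pair $(\Lambda,E)$ with $\Lambda\in\mathcal V^2(M)$ and $E$ a vector field such that $[\Lambda,\Lambda]=2E\wedge\Lambda$ and $[E,\Lambda]=0$. For a $1$-form $\alpha$, $\#_\Lambda(\alpha)$ is the vector field defined by $\beta(\#_\Lambda(\alpha))=\Lambda(\alpha,\beta)$ for all 1-forms $\beta$. The Lichnerowicz-Jacobi (LJ) cohomology $H^*_{LJ}(M,\Lambda,E)$ is the cohomology of the complex $(\mathcal V^*(M)\oplus\mathcal V^{*-1}(M),\sigma)$,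 where $\sigma:\mathcal V^k(M)\oplus\mathcal V^{k-1}(M)\to\mathcal V^{k+1}(M)\oplus\mathcal V^k(M)$ is $$\sigma(P,Q)=\big(-[\Lambda,P]+kE\wedge P+\Lambda\wedge Q,\ [\Lambda,Q]-(k-1)E\wedge Q+[E,P]\big),\qquad \sigma^2=0.$$ *)

(* Defs.v *)
From HB Require Import structures.
From mathcomp Require Import all_boot all_order all_algebra.
From mathcomp Require Import generic_quotient ring_quotient.
From mathcomp Require Import all_classical all_reals all_analysis.
From mathcomp Require Import zify ring lra.
Set Implicit Arguments.
Unset Strict Implicit.
Unset Printing Implicit Defensive.
Import Order.TTheory GRing.Theory Num.Theory numFieldNormedType.Exports.
Local Open Scope classical_set_scope.
Local Open Scope ring_scope.

Section smooth_maps.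
Variables (R : realType) (V W : normedModType R).

(* f is continuous on the open set U together with all its iterated directional
   derivatives of order at most k *)
Fixpoint Ck (U : set V) (k : nat) (f : V -> W) : Prop :=
  (forall x, U x -> {for x, continuous f}) /\
  match k with
  | 0 => True
  | k'.+1 => forall v, (forall x, U x -> derivable f x v) /\
                       Ck U k' (fun x => 'D_v f x)
  end.

Definition smooth_on (U : set V) (f : V -> W) := forall k, Ck U k f.

End smooth_maps.

Section smooth_closure.
Variables (R : realType) (V : normedModType R).
Implicit Types (U : set V) (f g : V -> R).

Lemma continuous_eq_on (W : normedModType R) U (f g : V -> W) :
  open U -> (forall x, U x -> f x = g x) ->
  (forall x, U x -> {for x, continuous f}) ->
  forall x, U x -> {for x, continuous g}.
Proof.
move=> oU fg cf x Ux; have := cf x Ux.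
rewrite /prop_for /continuous_at -(fg _ Ux) => h.
apply: cvg_trans h; apply: near_eq_cvg; near=> y; apply: fg.
by near: y; exact: open_nbhs_nbhs.
Unshelve. all: by end_near. Qed.

Lemma Ck_eq (W : normedModType R) U k (f g : V -> W) :
  open U -> (forall x, U x -> f x = g x) -> Ck U k f -> Ck U k g.
Proof.
move=> oU; elim: k f g => [|k IH] f g fg [cf Df].
  by split=> //; exact: continuous_eq_on cf.
split=> [|v]; first exact: continuous_eq_on cf.
have nfg x : U x -> \near x, f x = g x.
  by move=> Ux; near=> y; apply: fg; near: y; exact: open_nbhs_nbhs.
have [df ckf] := Df v; split=> [x Ux|].
  exact: near_eq_derivable (nfg _ Ux) (df _ Ux).
by apply: IH ckf => x Ux; exact: near_eq_derive (nfg _ Ux).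
Unshelve. all: by end_near. Qed.

Lemma Ck_cst (W : normedModType R) U k (c : W) : Ck U k (cst c : V -> W).
Proof.
elim: k c => [|k IH] c; split=> //; do ?[by move=> x _; exact: cvg_cst].
move=> v; split=> [x _|]; first exact: derivable_cst.
have -> : (fun x => 'D_v (cst c : V -> W) x) = cst 0.
  by apply/funext => x; rewrite derive_cst.
exact: IH.
Qed.

Lemma CkS (W : normedModType R) U k (f : V -> W) : Ck U k.+1 f -> Ck U k f.
Proof.
elim: k f => [|k IH] f [cf Df]; split=> // v.
by have [df /IH] := Df v; split.
Qed.

Lemma CkD U k f g : open U -> Ck U k f -> Ck U k g -> Ck U k (f + g).
Proof.
move=> oU; elim: k f g => [|k IH] f g [cf Df] [cg Dg].
  split; last by [].
  by move=> x Ux; apply: continuousD; [exact: cf | exact: cg].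
split.
- by move=> x Ux; apply: continuousD; [exact: cf | exact: cg].
- move=> v; have [df kf] := Df v; have [dg kg] := Dg v; split=> [x Ux|].
    by apply: derivableD; [exact: df | exact: dg].
  apply: (Ck_eq oU _ (IH _ _ kf kg)) => x Ux.
  by rewrite deriveD //; [exact: df | exact: dg].
Qed.

Lemma CkM U k f g : open U -> Ck U k f -> Ck U k g -> Ck U k (f * g).
Proof.
move=> oU; elim: k f g => [|k IH] f g F G.
  have [cf _] := F; have [cg _] := G; split; last by [].
  move=> x Ux.
  by apply: continuousM; [exact: cf | exact: cg].
have [cf Df] := F; have [cg Dg] := G; split=> [x Ux|v].
  by apply: continuousM; [exact: cf | exact: cg].
have [df kf] := Df v; have [dg kg] := Dg v; split=> [x Ux|].
  by apply: derivableM; [exact: df | exact: dg].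
apply: (Ck_eq oU _ (CkD oU (IH _ _ (CkS F) kg) (IH _ _ (CkS G) kf))) => x Ux.
by rewrite deriveM //; [exact: df | exact: dg].
Qed.

End smooth_closure.

(* chart_map is a homeomorphism from chart_dom onto its image, with inverse
   chart_inv; the values outside of these sets are irrelevant. *)
Record chart (M : topologicalType) (V : topologicalType) := Chart {
  chart_dom : set M;
  chart_map : M -> V;
  chart_inv : V -> M;
  chart_dom_open : open chart_dom;
  chart_im_open : open (chart_map @` chart_dom);
  chart_mapK : {in chart_dom, cancel chart_map chart_inv};
  chart_map_cont : forall x, chart_dom x -> {for x, continuous chart_map};
  chart_inv_cont : forall y, (chart_map @` chart_dom) y ->
    {for y, continuous chart_inv} }.

Record manifold (R : realType) (n : nat) := Manifold {
  points :> topologicalType;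
  atlas : set (chart points 'rV[R]_n);
  manifold_hausdorff : hausdorff_space points;
  manifold_second_countable : @second_countable points;
  manifold_connected : connected [set: points];
  atlas_cover : forall x, exists2 c, atlas c & chart_dom c x;
  atlas_smooth : forall c d, atlas c -> atlas d ->
    smooth_on (chart_map c @` (chart_dom c `&` chart_dom d))
              (chart_map d \o chart_inv c) }.

Section smooth_functions.
Variables (R : realType) (n : nat) (M : manifold R n).

Definition smooth (f : M -> R) := forall c, atlas c ->
  smooth_on (chart_map c @` chart_dom c) (f \o chart_inv c).

Definition smooth_pred : {pred M -> R} := fun f => `[< smooth f >].

Lemma smooth_subring : subring_closed smooth_pred.
Proof.
split=> [|f g /asboolP sf /asboolP sg|f g /asboolP sf /asboolP sg].
- apply/asboolP => c Ac k; exact: Ck_cst.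
- apply/asboolP => c Ac k; have oc := chart_im_open c.
  apply: (CkD oc (sf _ Ac k)).
  apply: (@Ck_eq _ _ _ _ _ (cst (-1) * (g \o chart_inv c)) _ oc).
    by move=> x _; rewrite /= mulN1r.
  by apply: CkM => //; [exact: Ck_cst | exact: sg].
- apply/asboolP => c Ac k; have oc := chart_im_open c.
  exact: (CkM oc (sf _ Ac k) (sg _ Ac k)).
Qed.

HB.instance Definition _ := GRing.isSubringClosed.Build _ smooth_pred
  smooth_subring.

Lemma smooth_scaler : GRing.scaler_closed smooth_pred.
Proof.
move=> a f sf; have -> : a *: f = cst a * f by apply/funext.
apply: rpredM => //; apply/asboolP => c Ac k; exact: Ck_cst.
Qed.

HB.instance Definition _ := GRing.isScaleClosed.Build R (M -> R) smooth_pred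
  smooth_scaler.

Record Cinfty := MkCinfty {
  Cinfty_val :> M -> R;
  CinftyP : Cinfty_val \in smooth_pred }.

HB.instance Definition _ := [isSub for Cinfty_val].
HB.instance Definition _ := [Choice of Cinfty by <:].
HB.instance Definition _ :=
  GRing.SubChoice_isSubComPzRing.Build _ _ Cinfty (subringClosedP smooth_pred).
HB.instance Definition _ := [SubZmodule_isSubLmodule of Cinfty by <:].

End smooth_functions.

Section multivectors.
Variables (R : realType) (n : nat) (M : manifold R n).
Local Notation F := (Cinfty M).

(* d_x f = d_x g, read in the charts around x *)
Definition same_differential (x : M) (f g : F) := forall c, atlas c ->
  chart_dom c x -> forall v,
  'D_v (f \o chart_inv c) (chart_map c x) =
  'D_v (g \o chart_inv c) (chart_map c x).

(* The cotangent space at x is { d_x f | f : F }, so a contravariant k-tensor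
   field P is determined by the functions P(df_1, ..., df_k) and is represented
   by the operator [:: f_1; ...; f_k] |-> P(df_1, ..., df_k), extended by 0 to
   the lists of length other than k. *)
Definition operator := seq F -> F.

HB.instance Definition _ := GRing.Lmodule.on operator.

Definition multilinear (P : operator) := forall s1 s2 (c : R) f g,
  P (s1 ++ (c *: f + g) :: s2) = c *: P (s1 ++ f :: s2) + P (s1 ++ g :: s2).

Definition skew_symmetric (P : operator) := forall s1 s2 s3 f g,
  P (s1 ++ f :: s2 ++ g :: s3) = - P (s1 ++ g :: s2 ++ f :: s3).

(* the value at x only depends on the covectors d_x f_i *)
Definition tensorial (P : operator) := forall x s1 s2 f g,
  same_differential x f g -> P (s1 ++ f :: s2) x = P (s1 ++ g :: s2) x.

Definition is_kvector (k : int) (P : operator) :=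
  [/\ forall s, size s != k :> int -> P s = 0,
      multilinear P, skew_symmetric P & tensorial P].

Definition kvector (k : int) : {pred operator} := fun P => `[< is_kvector k P >].

Lemma kvectorP k P : reflect (is_kvector k P) (P \in kvector k).
Proof. exact: asboolP. Qed.

Lemma kvector_submod k : GRing.submod_closed (kvector k).
Proof.
split=> [|c P Q /kvectorP[P0 Pl Ps Pt] /kvectorP[Q0 Ql Qs Qt]]; apply/kvectorP.
  split=> // [s1 s2 c f g|s1 s2 s3 f g]; first by rewrite scaler0 addr0.
  by rewrite oppr0.
have E s : (c *: P + Q) s = c *: P s + Q s by [].
split=> [s sk|s1 s2 d f g|s1 s2 s3 f g|x s1 s2 f g fg].
- by rewrite E P0 // Q0 // scaler0 addr0.
- rewrite !E Pl Ql !scalerDr !scalerA [d * c]mulrC !addrA; congr (_ + _).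
  by rewrite -!addrA; congr (_ + _); rewrite addrC.
- by rewrite !E Ps Qs scalerN opprD.
- have Ev (u v : F) : (c *: u + v) x = c * u x + v x by [].
  by rewrite !E !Ev (Pt _ _ _ _ _ fg) (Qt _ _ _ _ _ fg).
Qed.

HB.instance Definition _ k := GRing.isSubmodClosed.Build R operator (kvector k)
  (kvector_submod k).

(* All the ways to split a list into two complementary subsequences (u, w),
   with the parity of the shuffle s |-> u ++ w. *)
Fixpoint unshuffles (T : Type) (s : seq T) : seq (bool * seq T * seq T) :=
  if s is x :: s' then
    [seq (t.1.1, x :: t.1.2, t.2) | t <- unshuffles s'] ++
    [seq (t.1.1 (+) odd (size t.1.2), t.1.2, x :: t.2) | t <- unshuffles s']
  else [:: (false, [::], [::])].

Definition wedge (P Q : operator) : operator := fun s =>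
  \sum_(t <- unshuffles s) (-1) ^+ t.1.1 * (P t.1.2 * Q t.2).

Definition insertion (P Q : operator) : operator := fun s =>
  \sum_(t <- unshuffles s) (-1) ^+ t.1.1 * P (Q t.1.2 :: t.2).

(* The Schouten-Nijenhuis bracket of P in V^p and Q in V^q; the signs are those
   for which [X, f] = X f, [X, P] = L_X P, [P, Q] = (-1)^(pq) [Q, P] and
   [P, Q /\ R] = [P, Q] /\ R + (-1)^(pq+q) Q /\ [P, R]. *)
Definition schouten (p q : int) (P Q : operator) : operator :=
  ((-1) ^ ((p - 1) * q) : R) *: insertion P Q
  + ((-1) ^ p : R) *: insertion Q P.

Definition fmul (a : F) (P : operator) : operator := fun s => a * P s.

(* #_L(da), characterised by dg(#_L(da)) = L(da, dg) *)
Definition sharp_d (L : operator) (a : F) : operator := fun s => L (a :: s).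

End multivectors.

Arguments kvector {R n} M k.
Arguments operator {R n} M.

Record jacobi_structure (R : realType) (n : nat) (M : manifold R n) := Jacobi {
  bivector : operator M;
  reeb : operator M;
  bivectorP : bivector \in kvector M 2;
  reebP : reeb \in kvector M 1;
  jacobi_LL : schouten 2 2 bivector bivector = (2 : R) *: wedge reeb bivector;
  jacobi_EL : schouten 1 2 reeb bivector = 0 }.

Section conformal_change.
Variables (R : realType) (n : nat) (M : manifold R n).
Variables (J : jacobi_structure M) (a : Cinfty M).
Local Notation L := (bivector J).
Local Notation E := (reeb J).

Definition conformal_bivector := fmul a L.
Definition conformal_reeb := sharp_d L a + fmul a E.

Lemma conformal_bivectorP : conformal_bivector \in kvector M 2.
Proof.
have /kvectorP[L0 Ll Ls Lt] := bivectorP J; apply/kvectorP.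
rewrite /conformal_bivector /fmul.
split=> [s sk|s1 s2 c f g|s1 s2 s3 f g|x s1 s2 f g fg].
- by rewrite L0 // mulr0.
- rewrite Ll; apply/val_inj/funext => x /=.
  by rewrite mulrDr; congr (_ + _); exact: mulrCA.
- by rewrite Ls mulrN.
- exact: (congr1 (fun u => a x * u) (Lt x s1 s2 f g fg)).
Qed.

Lemma conformal_reebP : conformal_reeb \in kvector M 1.
Proof.
have /kvectorP[L0 Ll Ls Lt] := bivectorP J.
have /kvectorP[E0 El Es Et] := reebP J; apply: rpredD; apply/kvectorP.
  rewrite /sharp_d.
  split=> [s sk|s1 s2 c f g|s1 s2 s3 f g|x s1 s2 f g fg].
  + by rewrite L0.
  + exact: (Ll (a :: s1)).
  + exact: (Ls (a :: s1)).
  + exact: (Lt x (a :: s1)).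
rewrite /fmul; split=> [s sk|s1 s2 c f g|s1 s2 s3 f g|x s1 s2 f g fg].
- by rewrite E0 // mulr0.
- rewrite El; apply/val_inj/funext => x /=.
  by rewrite mulrDr; congr (_ + _); exact: mulrCA.
- by rewrite Es mulrN.
- exact: (congr1 (fun u => a x * u) (Et x s1 s2 f g fg)).
Qed.

End conformal_change.

Lemma deriveM_frozen (R : realType) (V : normedModType R) (u w : V -> R) y v :
  derivable u y v -> derivable w y v ->
  'D_v (fun z => u z * w z) y =
  'D_v (fun z => u y *: w z + (w y *: u z + 0)) y.
Proof.
move=> du dw; have -> : (fun z => u y *: w z + (w y *: u z + 0)) =
    (u y \*: w) + (w y \*: u) by apply/funext => z /=; rewrite addr0.
rewrite deriveD; [|exact: derivableZ|exact: derivableZ].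
by rewrite (deriveZ _ dw) (deriveZ _ du) -(deriveM du dw).
Qed.

Section graded.
Variables (R : realType) (n : nat) (M : manifold R n).
Local Notation F := (Cinfty M).
Implicit Types (P Q : operator M) (p q : int) (f g h : F).

Lemma unshuffles_size (T : eqType) (s : seq T) t :
  t \in unshuffles s -> (size t.1.2 + size t.2 = size s)%N.
Proof.
elim: s t => [|x s IH] t /=; first by rewrite inE => /eqP ->.
by rewrite mem_cat => /orP[] /mapP[u /IH <- ->] //=; rewrite addnS.
Qed.

Lemma kvector_size p P s : P \in kvector M p -> P s != 0 -> size s = p :> int.
Proof. by move=> /kvectorP[P0 _ _ _]; apply: contraNeq => /P0 ->. Qed.

Lemma multilinear0 P s1 s2 : multilinear P -> P (s1 ++ 0 :: s2) = 0.
Proof.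
by move=> /(_ s1 s2 (-1) 0 0); rewrite scaler0 addr0 scaleN1r addNr.
Qed.

Lemma wedge_support p q P Q s : P \in kvector M p -> Q \in kvector M q ->
  size s != p + q :> int -> wedge P Q s = 0.
Proof.
move=> Pp Qq; apply: contraNeq; apply: contraNeq => ss.
rewrite /wedge big_seq big1 // => t /unshuffles_size ts.
have [->|/(kvector_size Pp) e1] := eqVneq (P t.1.2) 0.
  by rewrite mul0r mulr0.
have [->|/(kvector_size Qq) e2] := eqVneq (Q t.2) 0.
  by rewrite !mulr0.
by move: ss; rewrite -ts PoszD e1 e2 eqxx.
Qed.

Lemma insertion_support p q P Q s : P \in kvector M p -> Q \in kvector M q ->
  (size s)%:Z + 1 != p + q -> insertion P Q s = 0.
Proof.
move=> Pp Qq; apply: contraNeq; apply: contraNeq => ss.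
rewrite /insertion big_seq big1 // => t /unshuffles_size ts.
have [->|/(kvector_size Pp) e1] := eqVneq (P (Q t.1.2 :: t.2)) 0.
  by rewrite mulr0.
have [->|/(kvector_size Qq) e2] := eqVneq (Q t.1.2) 0.
  have /kvectorP[_ Pl _ _] := Pp.
  by rewrite (multilinear0 [::]) // mulr0.
by move: ss e1; rewrite -ts -e2 /=; lia.
Qed.

Lemma Cinfty_derivable f x c v : atlas c -> chart_dom c x ->
  derivable (f \o chart_inv c) (chart_map c x) v.
Proof.
move=> Ac cx; have /asboolP /(_ _ Ac 1%N) [_ /(_ v) [d _]] := CinftyP f.
by apply: d; exists x.
Qed.

Lemma leibniz p P s1 s2 f g : P \in kvector M p ->
  P (s1 ++ (f * g) :: s2) = f * P (s1 ++ g :: s2) + g * P (s1 ++ f :: s2).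
Proof.
move=> /kvectorP[_ Pl _ Pt]; apply/val_inj/funext => x.
rewrite -[LHS]/(P (s1 ++ (f * g) :: s2) x).
rewrite (Pt x s1 s2 _ (f x *: g + (g x *: f + 0))) => [|c Ac cx v].
  by rewrite !Pl multilinear0 // addr0.
have cK : chart_inv c (chart_map c x) = x by rewrite chart_mapK // mem_set.
have df := Cinfty_derivable (f := f) (v := v) Ac cx.
have dg := Cinfty_derivable (f := g) (v := v) Ac cx.
have := deriveM_frozen df dg; rewrite /= cK => <-.
by congr ('D_v _ _).
Qed.

Lemma insertion22 P Q f g h : P \in kvector M 2 ->
  insertion P Q [:: f; g; h] =
  P [:: Q [:: f; g]; h] - P [:: Q [:: f; h]; g] + P [:: Q [:: g; h]; f].
Proof.
move=> /kvectorP[P0 _ _ _]; rewrite /insertion /= !big_cons big_nil /=.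
rewrite (P0 [:: _]) // (P0 [:: _; _; _]) // (P0 [:: _; _; _]) //.
rewrite (P0 [:: _; _; _]) // (P0 [:: _; _; _; _]) //.
by rewrite /= !(mulr0, add0r, addr0) !(expr0, mul1r) expr1 mulN1r addrA.
Qed.

Lemma insertion12 P Q g h : P \in kvector M 1 ->
  insertion P Q [:: g; h] = P [:: Q [:: g; h]].
Proof.
move=> /kvectorP[P0 _ _ _]; rewrite /insertion /= !big_cons big_nil /=.
rewrite (P0 [:: _; _]) // (P0 [:: _; _]) // (P0 [:: _; _; _]) //.
by rewrite /= !(mulr0, add0r, addr0) expr0 mul1r.
Qed.

Lemma insertion21 P Q g h : P \in kvector M 2 ->
  insertion P Q [:: g; h] = P [:: Q [:: g]; h] - P [:: Q [:: h]; g].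
Proof.
move=> /kvectorP[P0 _ _ _]; rewrite /insertion /= !big_cons big_nil /=.
rewrite (P0 [:: _]) // (P0 [:: _; _; _]) //.
by rewrite /= !(mulr0, add0r, addr0) expr0 expr1 mul1r mulN1r.
Qed.

Lemma wedge12 P Q f g h : P \in kvector M 1 ->
  wedge P Q [:: f; g; h] =
  P [:: f] * Q [:: g; h] - P [:: g] * Q [:: f; h] + P [:: h] * Q [:: f; g].
Proof.
move=> /kvectorP[P0 _ _ _]; rewrite /wedge /= !big_cons big_nil /=.
rewrite (P0 [:: _; _]) // (P0 [:: _; _]) // (P0 [:: _; _]) //.
rewrite (P0 [::]) // (P0 [:: _; _; _]) //.
by rewrite /= !(mul0r, mulr0, add0r, addr0) !(expr0, mul1r) expr1 mulN1r
  addrA.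
Qed.

End graded.

Section conformal_jacobi.
Variables (R : realType) (n : nat) (M : manifold R n).
Variables (J : jacobi_structure M) (a : Cinfty M).
Local Notation F := (Cinfty M).
Local Notation L := (bivector J).
Local Notation E := (reeb J).

Let opE (c d : R) (P Q : operator M) s : (c *: P + d *: Q) s = c *: P s + d *: Q s.
Proof. by []. Qed.
Let opZ (c : R) (P : operator M) s : (c *: P) s = c *: P s.
Proof. by []. Qed.
Let opD (P Q : operator M) s : (P + Q) s = P s + Q s.
Proof. by []. Qed.
Let evD (u v : F) x : (u + v) x = u x + v x. Proof. by []. Qed.
Let evN (u : F) x : (- u) x = - u x. Proof. by []. Qed.
Let evM (u v : F) x : (u * v) x = u x * v x. Proof. by []. Qed.
Let evZ (c : R) (u : F) x : (c *: u) x = c * u x. Proof. by []. Qed.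
Let evE := (evD, evN, evM, evZ).

Let Cinfty_eq (u v : F) : (forall x, u x = v x) -> u = v.
Proof. by move=> uv; apply/val_inj/funext. Qed.

Let sign2 : (-1 : R) ^ 2 = 1.
Proof. by rewrite -exprnP sqrrN expr1n. Qed.

Let sign22 : (-1 : R) ^ ((2 - 1) * 2) = 1.
Proof. by rewrite (_ : (2 - 1) * 2 = 2) // sign2. Qed.

Let jacobi_LLE f g h x :
  L [:: L [:: g; h]; f] x = L [:: L [:: f; h]; g] x - L [:: L [:: f; g]; h] x +
  (E [:: f] x * L [:: g; h] x - E [:: g] x * L [:: f; h] x
   + E [:: h] x * L [:: f; g] x).
Proof.
have := congr1 (fun P : operator M => P [:: f; g; h] x) (jacobi_LL J).
have -> : schouten 2 2 L L = (1 : R) *: insertion L L + (1 : R) *: insertion L L.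
  by rewrite /schouten !sign22 ?sign2.
rewrite opE opZ insertion22 ?wedge12 ?reebP ?bivectorP // !evE => H.
by lra.
Qed.

Let jacobi_ELE g h x :
  E [:: L [:: g; h]] x = L [:: E [:: g]; h] x - L [:: E [:: h]; g] x.
Proof.
have := congr1 (fun P : operator M => P [:: g; h] x) (jacobi_EL J).
rewrite /schouten opE insertion12 ?insertion21 ?reebP ?bivectorP // !evE.
rewrite subrr mul0r expr0z expr1z -[RHS]/0 => H; lra.
Qed.

Let LD u v w : L [:: u + v; w] = L [:: u; w] + L [:: v; w].
Proof.
have /kvectorP[_ Ll _ _] := bivectorP J.
by have := Ll [::] [:: w] 1 u v; rewrite !scale1r.
Qed.

Let Lskew u v : L [:: u; v] = - L [:: v; u].
Proof. by have /kvectorP[_ _ Ls _] := bivectorP J; exact: (Ls [::] [::] [::]). Qed.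

Let LM u v w : L [:: u * v; w] = u * L [:: v; w] + v * L [:: u; w].
Proof. exact: (leibniz [::] [:: w] u v (bivectorP J)). Qed.

Let EM u v : E [:: u * v] = u * E [:: v] + v * E [:: u].
Proof. exact: (leibniz [::] [::] u v (reebP J)). Qed.

Lemma conformal_LL :
  schouten 2 2 (conformal_bivector J a) (conformal_bivector J a) =
  (2 : R) *: wedge (conformal_reeb J a) (conformal_bivector J a).
Proof.
apply/funext => s.
have La := conformal_bivectorP J a; have Ea := conformal_reebP J a.
rewrite /schouten opE opZ.
have [s3|s3] := eqVneq (size s) 3; last first.
  rewrite !(insertion_support La La); last by rewrite -PoszD addn1.
  by rewrite (wedge_support Ea La) // !scaler0 addr0.
case: s s3 => [|f[|g[|h[|? ?]]]] //= _.
rewrite !insertion22 // !wedge12 //; apply: Cinfty_eq => x.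
rewrite /conformal_bivector /conformal_reeb /fmul /sharp_d.
rewrite !LM !evE (jacobi_LLE f g h).
rewrite !sign22 ?sign2.
by ring.
Qed.

Lemma conformal_EL :
  schouten 1 2 (conformal_reeb J a) (conformal_bivector J a) = 0.
Proof.
apply/funext => s.
have La := conformal_bivectorP J a; have Ea := conformal_reebP J a.
rewrite /schouten opE -[RHS]/0.
have [s2|s2] := eqVneq (size s) 2; last first.
  rewrite (insertion_support Ea La) ?(insertion_support La Ea).
  - by rewrite !scaler0 addr0.
  - by rewrite -PoszD addn1.
  - by rewrite -PoszD addn1.
case: s s2 => [|g[|h[|? ?]]] //= _.
rewrite insertion12 // insertion21 //; apply: Cinfty_eq => x.
rewrite /conformal_bivector /conformal_reeb /fmul /sharp_d.
rewrite !opD !(Lskew a (a * _)) !(LM, LD, EM) !evE.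
have -> : L [:: a; a] x = 0.
  by have := congr1 (fun u : F => u x) (Lskew a a); rewrite evN => ?; lra.
rewrite (jacobi_LLE a g h) jacobi_ELE subrr mul0r expr0z expr1z.
by rewrite -[RHS]/(0 : R); ring.
Qed.
End conformal_jacobi.

(* L_a = a L and E_a = #_L(da) + a E; positivity of a is not needed for this to
   be a Jacobi structure. *)
Definition conformal (R : realType) (n : nat) (M : manifold R n)
    (J : jacobi_structure M) (a : Cinfty M) : jacobi_structure M :=
  Jacobi (conformal_bivectorP J a) (conformal_reebP J a)
    (conformal_LL J a) (conformal_EL J a).

Section quotient_lmodule.
Variables (R : pzRingType) (V : lmodType R) (B : submodClosed V).
Local Open Scope quotient_scope.

(* B with its additive subgroup structure, as required by Quotient.quot *)
Definition submod_subgroup : {pred V} := fun x => x \in B.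

Lemma submod_subgroup_zmod : zmod_closed submod_subgroup.
Proof.
split=> [|x y Bx By]; first exact: rpred0.
by rewrite -scaleN1r; apply: rpredD => //; exact: rpredZ.
Qed.

HB.instance Definition _ := GRing.isZmodClosed.Build V submod_subgroup
  submod_subgroup_zmod.

Local Notation Q := (Quotient.quot submod_subgroup).

Definition quot_scale (c : R) (u : Q) : Q := \pi_Q (c *: repr u).

Lemma pi_quot_scale c x : quot_scale c (\pi_Q x) = \pi_Q (c *: x).
Proof.
apply/eqP; rewrite -(Quotient.idealrBE submod_subgroup) -scalerBr.
rewrite -[_ \in _]/(c *: (repr (\pi_Q x) - x) \in B); apply: rpredZ.
by rewrite -[_ \in _]/(_ \in submod_subgroup) Quotient.idealrBE reprK.
Qed.

Lemma quot_scaleA c d u :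
  quot_scale c (quot_scale d u) = quot_scale (c * d) u.
Proof. by rewrite -[u]reprK (pi_quot_scale d) !pi_quot_scale scalerA. Qed.

Lemma quot_scale1 : left_id 1 quot_scale.
Proof. by move=> u; rewrite -[u]reprK pi_quot_scale scale1r. Qed.

Lemma quot_scaleDr : right_distributive quot_scale +%R.
Proof.
move=> c u v; rewrite -[u]reprK -[v]reprK -pi_addr !pi_quot_scale.
by rewrite scalerDr pi_addr.
Qed.

Lemma quot_scaleDl u : {morph quot_scale^~ u : c d / c + d}.
Proof.
by move=> c d; rewrite -[u]reprK !pi_quot_scale scalerDl pi_addr.
Qed.

HB.instance Definition _ := GRing.Zmodule_isLmodule.Build R Q
  quot_scaleA quot_scale1 quot_scaleDr quot_scaleDl.

End quotient_lmodule.

Section lj_complex.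
Variables (R : realType) (n : nat) (M : manifold R n).
Variables (J : jacobi_structure M).
Local Notation L := (bivector J).
Local Notation E := (reeb J).
Implicit Types (k : int) (P Q : operator M) (z : operator M * operator M).

(* V^k(M) (+) V^(k-1)(M); kvector M j is 0 for j < 0, as no list has a negative
   length. *)
Definition lj_cochain k : {pred operator M * operator M} :=
  fun z => (z.1 \in kvector M k) && (z.2 \in kvector M (k - 1)).

Lemma lj_cochain_submod k : GRing.submod_closed (lj_cochain k).
Proof.
split=> [|c z w /andP[z1 z2] /andP[w1 w2]]; apply/andP; split.
- exact: rpred0.
- exact: rpred0.
- by apply: rpredD => //; exact: rpredZ.
- by apply: rpredD => //; exact: rpredZ.
Qed.

HB.instance Definition _ k := GRing.isSubmodClosed.Build R _ (lj_cochain k)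
  (lj_cochain_submod k).

Definition lj_diff k z : operator M * operator M :=
  (- schouten 2 k L z.1 + (k%:~R : R) *: wedge E z.1 + wedge L z.2,
   schouten 2 (k - 1) L z.2 - ((k - 1)%:~R : R) *: wedge E z.2
   + schouten 1 k E z.1).

Let mulZ (c : R) (u v : Cinfty M) : u * (c *: v) = c *: (u * v).
Proof.
by apply: val_inj; apply/funext => x; exact: (mulrCA (u x) c (v x)).
Qed.

Lemma wedge_linear P (c : R) Q1 Q2 :
  wedge P (c *: Q1 + Q2) = c *: wedge P Q1 + wedge P Q2.
Proof.
apply/funext => s; rewrite /wedge.
rewrite -[RHS]/(c *: (\sum_(t <- _) _) + \sum_(t <- _) _).
rewrite scaler_sumr -big_split; apply: eq_bigr => t _ /=.
by rewrite -[(_ + _) t.2]/(c *: Q1 t.2 + Q2 t.2) !mulrDr !mulZ.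
Qed.

Lemma insertion_linearl P (c : R) Q1 Q2 :
  insertion (c *: Q1 + Q2) P = c *: insertion Q1 P + insertion Q2 P.
Proof.
apply/funext => s; rewrite /insertion.
rewrite -[RHS]/(c *: (\sum_(t <- _) _) + \sum_(t <- _) _).
rewrite scaler_sumr -big_split; apply: eq_bigr => t _ /=.
by rewrite -[(c *: Q1 + Q2) _]/(c *: Q1 _ + Q2 _) mulrDr mulZ.
Qed.

Lemma insertion_linearr P (c : R) Q1 Q2 : multilinear P ->
  insertion P (c *: Q1 + Q2) = c *: insertion P Q1 + insertion P Q2.
Proof.
move=> Pl; apply/funext => s; rewrite /insertion.
rewrite -[RHS]/(c *: (\sum_(t <- _) _) + \sum_(t <- _) _).
rewrite scaler_sumr -big_split; apply: eq_bigr => t _ /=.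
rewrite -[(c *: Q1 + Q2) _]/(c *: Q1 _ + Q2 _).
by rewrite (Pl [::]) mulrDr mulZ.
Qed.

Lemma schouten_linear p q P (c : R) Q1 Q2 : multilinear P ->
  schouten p q P (c *: Q1 + Q2) = c *: schouten p q P Q1 + schouten p q P Q2.
Proof.
move=> Pl; rewrite /schouten insertion_linearl insertion_linearr //.
rewrite !scalerDr !scalerA ![_ * c]mulrC -!addrA; congr (_ + _).
by rewrite addrCA.
Qed.

Lemma lj_diff_linear k (c : R) z w :
  lj_diff k (c *: z + w) = c *: lj_diff k z + lj_diff k w.
Proof.
have /kvectorP[_ Ll _ _] := bivectorP J; have /kvectorP[_ El _ _] := reebP J.
have AC (U : zmodType) (a b d a' b' d' : U) :
    (a + a') + (b + b') + (d + d') = (a + b + d) + (a' + b' + d').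
  by rewrite [RHS]addrACA [X in X + _]addrACA.
rewrite /lj_diff; congr pair => /=.
  rewrite schouten_linear // !wedge_linear.
  move: (schouten _ _ _ z.1) (schouten _ _ _ w.1) => S S'.
  by rewrite !scalerDr !scalerN !scalerA ![_ * c]mulrC opprD AC.
rewrite !schouten_linear // wedge_linear.
move: (schouten _ _ _ z.1) (schouten _ _ _ w.1) => S S'.
move: (schouten _ _ _ z.2) (schouten _ _ _ w.2) => T T'.
by rewrite !scalerDr !scalerN !scalerA ![_ * c]mulrC opprD AC.
Qed.

Definition lj_cocycle k : {pred operator M * operator M} :=
  fun z => (z \in lj_cochain k) && (lj_diff k z == 0).

Lemma lj_cocycle_submod k : GRing.submod_closed (lj_cocycle k).
Proof.
have D0 : lj_diff k 0 = 0.
  by have := lj_diff_linear k (-1) 0 0; rewrite scaler0 addr0 scaleN1r addNr.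
split=> [|c z w /andP[z1 /eqP z2] /andP[w1 /eqP w2]]; apply/andP; split.
- exact: rpred0.
- by rewrite D0.
- by apply: rpredD => //; exact: rpredZ.
- by rewrite lj_diff_linear z2 w2 scaler0 addr0.
Qed.

HB.instance Definition _ k := GRing.isSubmodClosed.Build R _ (lj_cocycle k)
  (lj_cocycle_submod k).

Record lj_cocycles k :=
  LjCocycle { lj_cocycle_val : operator M * operator M;
              lj_cocycleP : lj_cocycle_val \in lj_cocycle k }.

HB.instance Definition _ k := [isSub for @lj_cocycle_val k].
HB.instance Definition _ k := [Choice of lj_cocycles k by <:].
HB.instance Definition _ k := [SubChoice_isSubLmodule of lj_cocycles k by <:].

(* As lj_diff squares to 0, lj_diff maps cochains to cocycles, and this is the
   whole image of lj_diff. *)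
Definition lj_coboundary k : {pred lj_cocycles k} :=
  fun z : lj_cocycles k =>
  `[< exists2 y, y \in lj_cochain (k - 1) & lj_diff (k - 1) y = val z >].

Lemma lj_coboundary_submod k : GRing.submod_closed (@lj_coboundary k).
Proof.
have D0 j : lj_diff j 0 = 0.
  by have := lj_diff_linear j (-1) 0 0; rewrite scaler0 addr0 scaleN1r addNr.
split=> [|c [z zc] [w wc] /asboolP[y yC yz] /asboolP[y' yC' yw]]; apply/asboolP.
  by exists 0; [exact: rpred0 | rewrite D0].
exists (c *: y + y'); first by apply: rpredD => //; exact: rpredZ.
by rewrite lj_diff_linear yz yw.
Qed.

HB.instance Definition _ k := GRing.isSubmodClosed.Build R _ (@lj_coboundary k)
  (lj_coboundary_submod k).

Definition lj_cohomology k := Quotient.quot (submod_subgroup (@lj_coboundary k)).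

HB.instance Definition _ k := GRing.Lmodule.on (lj_cohomology k).

End lj_complex.

(* Main.v *)
(* A cochain (P, Q) is a C^oo(M)-multilinear skew form
   D(f_1, ..., f_k) = P(df_1, ..., df_k)
                      + sum_i (-1)^(i+1) f_i Q(df_1, .. no df_i .., df_k)
   on the 1-jet Lie algebroid of the Jacobi manifold, and sigma is the
   differential of this algebroid. As {f, g}_a = {a f, a g} / a, the map
   j^1 f |-> j^1 (a f) is an isomorphism from the algebroid of (Lambda_a, E_a)
   to that of (Lambda, E). Pulling D back along it gives the isomorphism of
   complexes
     (P, Q) |-> (a^k P, a^(k-1) i_da P + a^k Q),
   which is checked to commute with sigma by means of the derivation
   properties of i_da and of the Schouten bracket. *)
From HB Require Import structures.
Require Import Defs.
From mathcomp Require Import all_boot all_order all_algebra.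
From mathcomp Require Import generic_quotient ring_quotient.
From mathcomp Require Import all_classical all_reals all_analysis.
From mathcomp Require Import zify ring lra.
Import Order.TTheory GRing.Theory Num.Theory numFieldNormedType.Exports.
Local Open Scope ring_scope.
Set Implicit Arguments.
Unset Strict Implicit.
Unset Printing Implicit Defensive.

(** * Preliminaries: smooth reciprocals, quotient modules and shuffles *)

Lemma CkV (R : realType) (V : normedModType R) (U : set V) k (f : V -> R) :
  open U -> (forall x, U x -> f x != 0) -> Ck U k f ->
  Ck U k (fun x => (f x)^-1).
Proof.
move=> oU f0; elim: k f f0 => [|k IH] f f0 Hf.
  have [cf _] := Hf; split=> // x Ux.
  by apply: continuousV; [exact: f0 | exact: cf].
have [cf Df] := Hf; split=> [x Ux|v].
  by apply: continuousV; [exact: f0 | exact: cf].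
have [df kf] := Df v; split=> [x Ux|].
  by apply: derivableV; [exact: f0 | exact: df].
(* The derivative of 1/f along v is -(1/f)^2 D_v f, a product of functions of class C^k: 1/f by
   induction, D_v f by [kf]. *)
have ckV := IH f f0 (CkS Hf).
have H := CkM oU (Ck_cst U k (-1 : R)) (CkM oU (CkM oU ckV ckV) kf).
apply: (@Ck_eq R V R U k _ _ oU _ H) => x Ux.
rewrite deriveV; [|exact: f0|exact: df].
by rewrite /= !fctE -[_ *: _]/(_ * _) expr2 invfM mulN1r mulNr.
Qed.

(** As [phi] is linear and matches the two submodules exactly, [phi] and [psi] both respect
    congruence, hence induce mutually inverse maps on classes. *)
Lemma quot_linear_iso (R : pzRingType) (V W : lmodType R)
    (B : submodClosed V) (C : submodClosed W)
    (phi : {linear V -> W}) (psi : W -> V) :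
  cancel phi psi -> cancel psi phi -> (forall x, (phi x \in C) = (x \in B)) ->
  exists f : {linear Quotient.quot (submod_subgroup B) ->
                     Quotient.quot (submod_subgroup C)}, bijective f.
Proof.
move=> phiK psiK phiBC.
pose QB : lmodType R := Quotient.quot (submod_subgroup B).
pose QC : lmodType R := Quotient.quot (submod_subgroup C).
pose piB (x : V) : QB := (\pi_(Quotient.quot (submod_subgroup B)) x)%qT.
pose piC (x : W) : QC := (\pi_(Quotient.quot (submod_subgroup C)) x)%qT.
have eqB x y : (piB x == piB y) = (x - y \in B).
  by rewrite -(Quotient.idealrBE (submod_subgroup B)).
have eqC x y : (piC x == piC y) = (x - y \in C).
  by rewrite -(Quotient.idealrBE (submod_subgroup C)).
have reprB (u : QB) : piB (repr u) = u by exact: reprK.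
have reprC (u : QC) : piC (repr u) = u by exact: reprK.
have linB c x y : piB (c *: x + y) = c *: piB x + piB y.
  rewrite /piB pi_addr; congr (_ + _); exact: (esym (pi_quot_scale B c x)).
have linC c x y : piC (c *: x + y) = c *: piC x + piC y.
  rewrite /piC pi_addr; congr (_ + _); exact: (esym (pi_quot_scale C c x)).
pose f (u : QB) : QC := piC (phi (repr u)).
pose g (u : QC) : QB := piB (psi (repr u)).
have fpi x : f (piB x) = piC (phi x).
  by apply/eqP; rewrite eqC -linearB phiBC -eqB reprB.
have gpi x : g (piC x) = piB (psi x).
  by apply/eqP; rewrite eqB -phiBC linearB !psiK -eqC reprC.
have f_lin : linear f.
  by move=> c u v; rewrite -[u]reprB -[v]reprB -linB !fpi linearP linC.
pose fl := GRing.isLinear.Build _ _ _ _ f f_lin.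
pose F : {linear QB -> QC} := HB.pack f fl.
exists F; exists g => u.
  by rewrite -[LHS]/(g (f u)) -[u]reprB fpi gpi phiK.
by rewrite -[LHS]/(f (g u)) -[u]reprC gpi fpi psiK.
Qed.

(** Exchanging the blocks u and w permutes the unshuffles and multiplies the sign by
    (-1)^(|u||w|). *)
Lemma unshuffles_swap (T : Type) (V : nmodType) (s : seq T)
    (G : bool * seq T * seq T -> V) :
  \sum_(t <- unshuffles s) G t =
  \sum_(t <- unshuffles s)
    G (t.1.1 (+) odd (size t.1.2 * size t.2), t.2, t.1.2).
Proof.
elim: s G => [|x s IH] G /=; first by rewrite !big_cons !big_nil.
(* The swap exchanges the half where [x] joins the first block with the half where it joins the
   second, hence [addrC]. *)
rewrite !big_cat !big_map /= addrC [X in X + _]IH [X in _ + X]IH.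
by congr (_ + _); apply: eq_bigr => -[[b u] w] _ /=; congr (G (_, _, _));
  rewrite ?mulSn ?mulnS !oddD; case: b; case: (odd (size u));
  case: (odd (size w)); case: (odd _).
Qed.

(** * Contraction, wedge and insertion of multivectors *)

Section calculus.
Variables (R : realType) (n : nat) (M : manifold R n).
Implicit Types (P Q : operator M) (p q k : int) (f g : Cinfty M) (c : R).

Lemma Cinfty_ext f g : (forall x, f x = g x) -> f = g.
Proof. by move=> fg; apply/val_inj/funext. Qed.

Lemma operator_ext P Q : (forall s x, P s x = Q s x) -> P = Q.
Proof. by move=> PQ; apply/funext => s; apply: Cinfty_ext. Qed.

Lemma fmul_kvector k f P : P \in kvector M k -> fmul f P \in kvector M k.
Proof.
move=> /kvectorP[P0 Pl Ps Pt]; apply/kvectorP; rewrite /fmul.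
split=> [s sk|s1 s2 c g h|s1 s2 s3 g h|x s1 s2 g h gh].
- by rewrite P0 // mulr0.
- rewrite Pl mulrDr; congr (_ + _).
  by apply: Cinfty_ext => x; exact: mulrCA.
- by rewrite Ps mulrN.
- exact: (congr1 (fun u => f x * u) (Pt x s1 s2 g h gh)).
Qed.

(** In any degree, [sharp_d P f] is the contraction i_df P in the first argument. *)
Lemma sharp_d_kvector k f P :
  P \in kvector M k -> sharp_d P f \in kvector M (k - 1).
Proof.
move=> /kvectorP[P0 Pl Ps Pt]; apply/kvectorP; rewrite /sharp_d.
split=> [s sk|s1 s2 c g h|s1 s2 s3 g h|x s1 s2 g h gh].
- by rewrite P0 //=; apply: contra sk => /eqP; lia.
- exact: (Pl (f :: s1)).
- exact: (Ps (f :: s1)).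
- exact: (Pt x (f :: s1)).
Qed.

Lemma sharp_d_sharp_d k f P : P \in kvector M k ->
  sharp_d (sharp_d P f) f = 0.
Proof.
move=> /kvectorP[_ _ Ps _]; apply: operator_ext => s x.
have H : P [:: f, f & s] x = - P [:: f, f & s] x.
  exact: (congr1 (fun u : Cinfty M => u x) (Ps [::] [::] s f f)).
by rewrite /sharp_d -[RHS]/(0 : R); lra.
Qed.

Let signM (b : bool) f : (-1) ^+ b * f = ((-1) ^+ b : R) *: f.
Proof.
by apply: Cinfty_ext => x; case: b; rewrite ?mulN1r ?scaleN1r ?mul1r ?scale1r.
Qed.

Let sign_odd m : ((-1) ^ (m%:Z) : R) = (-1) ^+ odd m.
Proof. by rewrite -exprnP signr_odd. Qed.

Lemma wedge_comm p q P Q : P \in kvector M p -> Q \in kvector M q ->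
  wedge P Q = ((-1) ^ (p * q) : R) *: wedge Q P.
Proof.
move=> Pp Qq; apply/funext => s; rewrite /wedge unshuffles_swap.
rewrite -[RHS]/(_ *: \sum_(t <- _) _) scaler_sumr.
apply: eq_bigr => -[[b u] w] _ /=.
(* Only blocks of sizes p and q contribute, so the sign of the swap is the constant (-1)^(pq). *)
have [->|/(kvector_size Pp) e1] := eqVneq (P w) 0.
  by rewrite mul0r !mulr0 scaler0.
have [->|/(kvector_size Qq) e2] := eqVneq (Q u) 0.
  by rewrite mul0r !mulr0 scaler0.
rewrite -e1 -e2 -PoszM sign_odd [(size w * _)%N]mulnC !signM scalerA.
by rewrite signr_addb [X in X *: _]mulrC [P w * _]mulrC.
Qed.

(** i_df is an antiderivation: [f] heads the list, so it either joins the block of [P] without a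
    sign or passes over its p entries to head the block of [Q]. *)
Lemma sharp_d_wedge p f P Q : P \in kvector M p ->
  sharp_d (wedge P Q) f =
  wedge (sharp_d P f) Q + ((-1) ^ p : R) *: wedge P (sharp_d Q f).
Proof.
move=> Pp; apply/funext => s; rewrite /sharp_d /wedge /=.
rewrite big_cat !big_map /=; congr (_ + _).
rewrite -[RHS]/(_ *: \sum_(t <- _) _) scaler_sumr.
apply: eq_bigr => -[[b u] w] _ /=.
have [->|/(kvector_size Pp) <-] := eqVneq (P u) 0.
  by rewrite mul0r !mulr0 scaler0.
by rewrite sign_odd !signM scalerA signr_addb mulrC.
Qed.

(** Either [f] heads the block of [Q], or it passes over that block with sign (-1)^q and becomes the
    second argument of [P]; moving it to the front gives the extra minus sign. *)
Lemma sharp_d_insertion p q f P Q : P \in kvector M p -> Q \in kvector M q ->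
  sharp_d (insertion P Q) f =
  insertion P (sharp_d Q f) - ((-1) ^ q : R) *: insertion (sharp_d P f) Q.
Proof.
move=> /kvectorP[_ Pl Ps _] Qq; apply/funext => s.
rewrite /sharp_d /insertion /=.
rewrite big_cat !big_map /=; congr (_ + _).
rewrite -[RHS]/(- (_ *: \sum_(t <- _) _)) scaler_sumr -sumrN.
apply: eq_bigr => -[[b u] w] _ /=.
have [->|/(kvector_size Qq) <-] := eqVneq (Q u) 0.
  rewrite (multilinear0 [::]) // (multilinear0 [:: f]) //.
  by rewrite !mulr0 scaler0 oppr0.
rewrite (Ps [::] [::] w) /= sign_odd !signM scalerA signr_addb.
by rewrite scalerN mulrC.
Qed.

(** Leibniz rule for [P] in the slot filled by f Q(u): the term differentiating f is Q(u) times
    (i_df P)(w). *)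
Lemma insertion_fmulr p f P Q : P \in kvector M p ->
  insertion P (fmul f Q) = fmul f (insertion P Q) + wedge Q (sharp_d P f).
Proof.
move=> Pp; apply/funext => s; rewrite /insertion /wedge /fmul /sharp_d.
rewrite -[RHS]/(_ * \sum_(t <- _) _ + \sum_(t <- _) _).
rewrite mulr_sumr -big_split; apply: eq_bigr => t _ /=.
by rewrite (leibniz [::] _ _ _ Pp) mulrDr mulrCA.
Qed.

Lemma insertion_fmull f P Q : insertion (fmul f P) Q = fmul f (insertion P Q).
Proof.
apply/funext => s; rewrite /insertion /fmul mulr_sumr.
by apply: eq_bigr => t _; rewrite mulrCA.
Qed.

Lemma wedge_fmull f P Q : wedge (fmul f P) Q = fmul f (wedge P Q).
Proof.
apply/funext => s; rewrite /wedge /fmul mulr_sumr.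
by apply: eq_bigr => t _; rewrite -mulrA mulrCA.
Qed.

Lemma wedge_fmulr f P Q : wedge P (fmul f Q) = fmul f (wedge P Q).
Proof.
apply/funext => s; rewrite /wedge /fmul mulr_sumr.
by apply: eq_bigr => t _; rewrite [P _ * _]mulrCA [LHS]mulrCA.
Qed.

Lemma wedgeDl P1 P2 Q : wedge (P1 + P2) Q = wedge P1 Q + wedge P2 Q.
Proof.
apply/funext => s; rewrite /wedge -[RHS]/(\sum_(t <- _) _ + \sum_(t <- _) _).
rewrite -big_split; apply: eq_bigr => t _ /=.
by rewrite -[(P1 + P2) _]/(P1 _ + P2 _) mulrDl mulrDr.
Qed.

Lemma wedge0r P : wedge P 0 = 0.
Proof.
apply/funext => s; rewrite /wedge big1 // => t _.
by rewrite -[0 t.2]/(0 : Cinfty M) !mulr0.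
Qed.

End calculus.

(** * Derivation properties of the Schouten bracket *)

Section schouten_calculus.
Variables (R : realType) (n : nat) (M : manifold R n).
Implicit Types (P Q : operator M) (p q k : int) (f g : Cinfty M) (c : R).

Lemma wedgeDr P Q1 Q2 : wedge P (Q1 + Q2) = wedge P Q1 + wedge P Q2.
Proof. by rewrite -[Q1]scale1r wedge_linear !scale1r. Qed.

Lemma wedge0l Q : wedge 0 Q = 0.
Proof.
apply/funext => s; rewrite /wedge big1 // => t _.
by rewrite -[0 t.1.2]/(0 : Cinfty M) mul0r mulr0.
Qed.

Lemma wedgeZl c P Q : wedge (c *: P) Q = c *: wedge P Q.
Proof.
apply/funext => s; rewrite /wedge -[RHS]/(c *: \sum_(t <- _) _) scaler_sumr.
apply: eq_bigr => t _; rewrite -[(c *: P) _]/(c *: P _).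
apply: Cinfty_ext => x.
by rewrite /= -[LHS]/(_ * (c * _ * _)) -[RHS]/(c * (_ * (_ * _))); ring.
Qed.

Lemma schoutenDl p q P1 P2 Q : multilinear Q ->
  schouten p q (P1 + P2) Q = schouten p q P1 Q + schouten p q P2 Q.
Proof.
move=> Ql; rewrite /schouten -[P1]scale1r.
rewrite insertion_linearl insertion_linearr //.
by rewrite !scale1r !scalerDr addrACA.
Qed.

Lemma schoutenDr p q P Q1 Q2 : multilinear P ->
  schouten p q P (Q1 + Q2) = schouten p q P Q1 + schouten p q P Q2.
Proof. by move=> Pl; rewrite -[Q1]scale1r schouten_linear // !scale1r. Qed.

Lemma fmulD f P Q : fmul f (P + Q) = fmul f P + fmul f Q.
Proof. by apply/funext => s; exact: mulrDr. Qed.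

Lemma fmulZ f c P : fmul f (c *: P) = c *: fmul f P.
Proof. by apply: operator_ext => s x; exact: mulrCA. Qed.

Lemma sign_sq k : (-1) ^ k * (-1) ^ k = 1 :> R.
Proof. by rewrite -expfzMl mulrNN mulr1 exp1rz. Qed.

(** The correction term arises as Q /\ i_df P; the sign of reordering it cancels the prefactor
    (-1)^((p-1)q) of the bracket. *)
Lemma schouten_fmulr p q f P Q : P \in kvector M p -> Q \in kvector M q ->
  schouten p q P (fmul f Q) = fmul f (schouten p q P Q) + wedge (sharp_d P f) Q.
Proof.
move=> Pp Qq; rewrite /schouten (insertion_fmulr _ _ Pp) insertion_fmull.
rewrite (wedge_comm Qq (sharp_d_kvector f Pp)) mulrC.
by rewrite scalerDr scalerA sign_sq scale1r fmulD !fmulZ addrAC.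
Qed.

Lemma schouten_fmull p q f P Q : P \in kvector M p -> Q \in kvector M q ->
  schouten p q (fmul f P) Q =
  fmul f (schouten p q P Q) + ((-1) ^ p : R) *: wedge P (sharp_d Q f).
Proof.
move=> Pp Qq; rewrite /schouten (insertion_fmulr _ _ Qq) insertion_fmull.
by rewrite scalerDr fmulD !fmulZ addrA.
Qed.

(** Since [P, f] = i_df P, this is the graded Jacobi identity with a function as one entry. It
    follows from the contraction rule for both insertions. *)
Lemma sharp_d_schouten p q f P Q : P \in kvector M p -> Q \in kvector M q ->
  sharp_d (schouten p q P Q) f =
  ((-1) ^ (p - 1) : R) *: schouten p (q - 1) P (sharp_d Q f)
  - schouten (p - 1) q (sharp_d P f) Q.
Proof.
move=> Pp Qq.
have N1 : (-1 : R) != 0 by rewrite oppr_eq0 oner_neq0.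
have s1 k : (-1) ^ (k - 1) = - (-1) ^ k :> R.
  by rewrite expfzDr // exprN1 invrN1 mulrN1.
have -> : sharp_d (schouten p q P Q) f =
    ((-1) ^ ((p - 1) * q) : R) *: sharp_d (insertion P Q) f
    + ((-1) ^ p : R) *: sharp_d (insertion Q P) f by [].
rewrite (sharp_d_insertion f Pp Qq) (sharp_d_insertion f Qq Pp) /schouten.
(* All signs are reduced to monomials in (-1)^p, (-1)^q and (-1)^((p-1)q), where repeated factors
   cancel. *)
have -> : (p - 1 - 1) * q = (p - 1) * q - q by ring.
have -> : (p - 1) * (q - 1) = (p - 1) * q - (p - 1) by ring.
have sN k : (-1) ^ (- k) = (-1) ^ k :> R.
  by rewrite -exprz_inv invrN1.
rewrite !(expfzDr _ _ N1) !sN !s1.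
have := sign_sq p; have := sign_sq q.
set u := (-1) ^ p; set v := (-1) ^ q; set w := (-1) ^ (_ * _).
move=> v2 u2.
rewrite !(scalerDr, scalerN, scaleNr, scalerA, opprD, opprK, mulrN, mulNr).
rewrite !mulr1 [u * (w * u)]mulrCA u2 mulr1 scale1r -!addrA; congr (_ + _).
by rewrite [RHS]addrC addrA.
Qed.

End schouten_calculus.

(** * Integer powers of a nowhere vanishing function *)

Section powers.
Variables (R : realType) (n : nat) (M : manifold R n) (a : Cinfty M).
Hypothesis a_neq0 : forall x, a x != 0.
Implicit Types (P Q : operator M) (k : int).

Lemma smooth_exprz k : (fun x => a x ^ k) \in smooth_pred (M:=M).
Proof.
have sa := CinftyP a.
have sV : (fun x => (a x)^-1) \in smooth_pred (M:=M).
  apply/asboolP => c Ac j; apply: (@CkV _ _ _ _ (a \o chart_inv c)).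
  - exact: chart_im_open.
  - by move=> x _; exact: a_neq0.
  - by have /asboolP := sa; apply.
have sX (g : M -> R) (m : nat) :
    g \in smooth_pred (M:=M) -> (fun x => g x ^+ m) \in smooth_pred (M:=M).
  move=> sg; have -> : (fun x => g x ^+ m) = g ^+ m.
    by apply/funext => x; elim: m => // m IH; rewrite !exprS IH.
  exact: rpredX.
case: k => m; first exact: sX.
have -> : (fun x => a x ^ (Negz m)) = (fun x => (a x)^-1 ^+ m.+1).
  by apply/funext => x; rewrite exprVn.
exact: sX.
Qed.

Definition Cinfty_exprz k : Cinfty M := MkCinfty (smooth_exprz k).

(** The rule d(a^k) = k a^(k-1) da, derived from the Leibniz rule alone: [DS] is a recursion for D
    that can be run in both directions because a is nonzero. *)
Lemma sharp_d_exprz p k P : P \in kvector M p ->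
  sharp_d P (Cinfty_exprz k) =
  (k%:~R : R) *: fmul (Cinfty_exprz (k - 1)) (sharp_d P a).
Proof.
move=> Pp; apply: operator_ext => s x.
pose D j : R := P (Cinfty_exprz j :: s) x.
rewrite -[LHS]/(D k) -[RHS]/(k%:~R * (a x ^ (k - 1) * P (a :: s) x)).
have DS j : D (j + 1) = a x * D j + a x ^ j * P (a :: s) x.
  rewrite /D; have -> : Cinfty_exprz (j + 1) = a * Cinfty_exprz j.
    by apply: Cinfty_ext => y; rewrite /= expfzDr // mulrC.
  by rewrite (leibniz [::] _ _ _ Pp).
have XS j : a x ^ j = a x * a x ^ (j - 1).
  by rewrite -[in LHS](subrK 1 j) expfzDr // mulrC.
elim/int_rect: k => [|m IH|m IH].
(* At j = 0 the recursion reads D 1 = a D 0 + D 1, which forces D 0 = 0. *)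
- have D1 : D (0 + 1) = P (a :: s) x.
    by rewrite /D; congr (P (_ :: s) x); apply: Cinfty_ext.
  have /eqP := DS 0; rewrite D1 expr0z mul1r -subr_eq subrr eq_sym.
  by rewrite mulf_eq0 (negPf (a_neq0 x)) mul0r => /eqP.
- by rewrite -addn1 PoszD DS IH addrK (XS m%:Z) intrD mulrDl; ring.
(* Downward step: the recursion at j = -(m+1) is solved for D j by cancelling the factor a. *)
- have := DS (- (m.+1)%:Z).
  rewrite (_ : - (m.+1)%:Z + 1 = - m%:Z); last by lia.
  rewrite IH => /eqP; rewrite -subr_eq => /eqP H.
  apply: (mulfI (a_neq0 x)).
  rewrite -H (_ : - (m.+1)%:Z = - m%:Z - 1); last by lia.
  by rewrite (XS (- m%:Z - 1)) intrB; ring.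
Qed.

End powers.

(* Syntactic evaluation at a list and a point: [rewrite] would have to unify
   pointwise operations up to conversion. *)
Ltac eval_operator R P s x :=
  lazymatch P with
  | ?A + ?B => let u := eval_operator R A s x in
               let v := eval_operator R B s x in constr:(u + v)
  | 0 => constr:(0 : R)
  | - ?A => let u := eval_operator R A s x in constr:(- u)
  | ?c *: ?A => let u := eval_operator R A s x in constr:(c * u)
  | fmul (Cinfty_exprz (a := ?a) _ ?k) ?A =>
      let u := eval_operator R A s x in constr:(a x ^ k * u)
  | fmul ?f ?A => let u := eval_operator R A s x in constr:(f x * u)
  | sharp_d ?A ?f => eval_operator R A constr:(f :: s) x
  | _ => constr:(P s x)
  end.

Ltac pointwise :=
  let s := fresh "s" in let x := fresh "x" in
  apply: operator_ext; intros s x;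
  lazymatch goal with |- @Cinfty_val ?R _ _ (?P s) x = Cinfty_val (?Q s) x =>
    let u := eval_operator R P s x in
    let v := eval_operator R Q s x in change (u = v)
  end.

(** * The isomorphism of cochains and its compatibility with the differentials *)

Section conformal_cochain.
Variables (R : realType) (n : nat) (M : manifold R n).
Variables (J : jacobi_structure M) (a : Cinfty M).
Hypothesis a_neq0 : forall x, a x != 0.
Implicit Types (P Q : operator M) (k : int) (z : operator M * operator M).
Local Notation L := (bivector J).
Local Notation E := (reeb J).
Local Notation apow := (Cinfty_exprz a_neq0).

Definition conformal_cochain k z : operator M * operator M :=
  (fmul (apow k) z.1,
   fmul (apow (k - 1)) (sharp_d z.1 a) + fmul (apow k) z.2).

(** The formula of [conformal_cochain] for 1/a: as d(1/a) = -a^(-2) da, the contraction term becomes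
    -a^(-k-1) i_da P. *)
Definition conformal_cochain_inv k z : operator M * operator M :=
  (fmul (apow (- k)) z.1,
   fmul (apow (- k)) z.2 - fmul (apow (- k - 1)) (sharp_d z.1 a)).

Let apowS k x : a x ^ k = a x * a x ^ (k - 1).
Proof. by rewrite -[in LHS](subrK 1 k) expfzDr // mulrC. Qed.

Lemma conformal_cochainK k :
  cancel (conformal_cochain k) (conformal_cochain_inv k).
Proof.
case=> P Q; rewrite /conformal_cochain /conformal_cochain_inv /=.
congr pair; pointwise.
  by rewrite mulrA -expfzDr // addNr expr0z mul1r.
rewrite mulrDr !mulrA -!expfzDr // addNr expr0z mul1r.
by rewrite (_ : - k + (k - 1) = - k - 1 + k); [ring | ring].
Qed.

Lemma conformal_cochain_invK k :
  cancel (conformal_cochain_inv k) (conformal_cochain k).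
Proof.
case=> P Q; rewrite /conformal_cochain /conformal_cochain_inv /=.
congr pair; pointwise.
  by rewrite mulrA -expfzDr // subrr expr0z mul1r.
rewrite mulrBr !mulrA -!expfzDr // subrr expr0z mul1r.
by rewrite (_ : k - 1 - k = k + (- k - 1)); [ring | ring].
Qed.

Lemma conformal_cochain_linear k (c : R) z w :
  conformal_cochain k (c *: z + w) =
  c *: conformal_cochain k z + conformal_cochain k w.
Proof.
by congr pair => /=; pointwise; ring.
Qed.

Lemma conformal_cochain_lj k z :
  (conformal_cochain k z \in lj_cochain (M:=M) k) = (z \in lj_cochain (M:=M) k).
Proof.
have fwd y : y \in lj_cochain k -> conformal_cochain k y \in lj_cochain k.
  move=> /andP[Pk Qk]; apply/andP; split; first exact: fmul_kvector.
  by apply: rpredD; apply: fmul_kvector => //; exact: sharp_d_kvector.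
apply/idP/idP => [|/fwd //].
rewrite -{2}[z](conformal_cochainK k); case: (conformal_cochain k z) => P Q.
move=> /andP[Pk Qk]; apply/andP; split; first exact: fmul_kvector.
apply: rpredB; apply: fmul_kvector => //; exact: sharp_d_kvector.
Qed.

Lemma conformal_cochain_diff k z : z \in lj_cochain (M:=M) k ->
  lj_diff (conformal J a) k (conformal_cochain k z) =
  conformal_cochain (k + 1) (lj_diff J k z).
Proof.
case: z => P Q /andP[/= Pk Qk].
have L2 := bivectorP J; have E1 := reebP J.
have X1 : sharp_d L a \in kvector M 1 := sharp_d_kvector a L2.
have aP := fmul_kvector (apow k) Pk.
have iP := sharp_d_kvector a Pk.
have aL := fmul_kvector a L2; have aE := fmul_kvector a E1.
have ml j T : T \in kvector M j -> multilinear T by case/kvectorP.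
rewrite /lj_diff /conformal_cochain /= /conformal_bivector /conformal_reeb.
rewrite !(schoutenDr, schoutenDl, wedgeDr, wedgeDl, wedge_fmull, wedge_fmulr);
  try exact: ml aL; try exact: ml aP.
have sgn2 : (-1) ^ 2 = 1 :> R by rewrite -exprnP sqrrN expr1n.
have sharp_fmul f g T : sharp_d (fmul f T) g = fmul f (sharp_d T g) by [].
have XX : sharp_d (sharp_d L a) a = 0 := sharp_d_sharp_d a L2.
congr pair.
  (* With X = #(da), the expansion of -[aL, a^k P] contains -a^k L /\ i_da P and -k a^k X /\ P. They
     cancel against the wedge of aL with a^(k-1) i_da P and the X-part of k E_a /\ a^k P. *)
  rewrite (schouten_fmulr _ aL Pk) (schouten_fmull _ L2 Pk).
  rewrite sharp_fmul (sharp_d_exprz _ _ L2) wedge_fmull wedgeZl wedge_fmull.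
  rewrite sgn2; pointwise; rewrite (apowS (k + 1)) addrK (apowS k); ring.
(* Here i_da X and i_da i_da P vanish, and -i_da [L, P] = [L, i_da P] + [X, P] accounts for the
   brackets containing i_da P and X. *)
rewrite (schouten_fmulr _ aL iP) (schouten_fmull _ L2 iP).
rewrite (schouten_fmulr _ aL Qk) (schouten_fmull _ L2 Qk).
rewrite (schouten_fmulr _ X1 Pk).
rewrite (schouten_fmulr _ aE Pk) (schouten_fmull _ E1 Pk).
rewrite !sharp_fmul !(sharp_d_exprz _ _ L2).
rewrite (sharp_d_exprz _ _ X1) (sharp_d_exprz _ _ E1).
rewrite (sharp_d_sharp_d a Pk) XX wedge0r.
have -> : sharp_d (- schouten 2 k L P + (k%:~R : R) *: wedge E P
                   + wedge L Q) a =
    - sharp_d (schouten 2 k L P) a + (k%:~R : R) *: sharp_d (wedge E P) a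
    + sharp_d (wedge L Q) a by [].
rewrite (sharp_d_schouten a L2 Pk) (sharp_d_wedge a P E1).
rewrite (sharp_d_wedge a Q L2).
have -> : (2 - 1 : int) = 1 by [].
rewrite !expr1z sgn2 !(wedge_fmull, wedgeZl) wedge0l.
(* Every power of a becomes a multiple of the lowest one, [a x ^ (k - 1 - 1)], so that [ring] can
   compare them. *)
pointwise; rewrite addrK (apowS (k + 1)) addrK (apowS k) (apowS (k - 1)) intrB.
ring.
Qed.

(** * Passage to cocycles, coboundaries and cohomology *)

Lemma conformal_cochain_cocycle k z :
  (conformal_cochain k z \in lj_cocycle (conformal J a) k) =
  (z \in lj_cocycle J k).
Proof.
rewrite -[LHS]/((_ \in lj_cochain (M:=M) k) && _) conformal_cochain_lj.
rewrite -[RHS]/((_ \in lj_cochain (M:=M) k) && _).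
have [zk|//] := boolP (z \in lj_cochain k); rewrite conformal_cochain_diff //=.
have C0 : conformal_cochain (k + 1) 0 = 0.
  have := conformal_cochain_linear (k + 1) (-1) 0 0.
  by rewrite scaler0 addr0 scaleN1r addNr.
(* Injectivity in degree k + 1: the differential of the image vanishes only if that of [z] does. *)
by rewrite -[in LHS]C0 (inj_eq (can_inj (conformal_cochainK (k + 1)))).
Qed.

Definition conformal_cocycle k (z : lj_cocycles J k) :
    lj_cocycles (conformal J a) k :=
  LjCocycle (etrans (conformal_cochain_cocycle k (val z)) (lj_cocycleP z)).

Lemma conformal_cocycle_linear k : linear (@conformal_cocycle k).
Proof. by move=> c z w; apply: val_inj; exact: conformal_cochain_linear. Qed.

HB.instance Definition _ k := GRing.isLinear.Build _ _ _ _
  (@conformal_cocycle k) (@conformal_cocycle_linear k).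

Lemma conformal_cochain_inv_cocycle k (z : lj_cocycles (conformal J a) k) :
  conformal_cochain_inv k (val z) \in lj_cocycle J k.
Proof.
by rewrite -conformal_cochain_cocycle conformal_cochain_invK lj_cocycleP.
Qed.

Definition conformal_cocycle_inv k (z : lj_cocycles (conformal J a) k) :
    lj_cocycles J k := LjCocycle (conformal_cochain_inv_cocycle z).

Lemma conformal_cocycleK k :
  cancel (@conformal_cocycle k) (@conformal_cocycle_inv k).
Proof. by move=> z; apply: val_inj; exact: conformal_cochainK. Qed.

Lemma conformal_cocycle_invK k :
  cancel (@conformal_cocycle_inv k) (@conformal_cocycle k).
Proof. by move=> z; apply: val_inj; exact: conformal_cochain_invK. Qed.

Lemma conformal_cocycle_coboundary k (z : lj_cocycles J k) :
  (conformal_cocycle z \in @lj_coboundary _ _ _ (conformal J a) k) =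
  (z \in @lj_coboundary _ _ _ J k).
Proof.
have diffE y : y \in lj_cochain (k - 1) ->
    lj_diff (conformal J a) (k - 1) (conformal_cochain (k - 1) y) =
    conformal_cochain k (lj_diff J (k - 1) y).
  by move=> yk; rewrite conformal_cochain_diff // subrK.
apply/asboolP/asboolP => -[y yk dy].
(* A primitive for the conformal structure is carried back by the inverse map; injectivity in degree
   k then identifies its differential. *)
- exists (conformal_cochain_inv (k - 1) y).
    by rewrite -conformal_cochain_lj conformal_cochain_invK.
  apply: (can_inj (conformal_cochainK k)).
  rewrite -diffE ?conformal_cochain_invK //.
  by rewrite -conformal_cochain_lj conformal_cochain_invK.
- exists (conformal_cochain (k - 1) y); first by rewrite conformal_cochain_lj.
  by rewrite diffE // dy.
Qed.

End conformal_cochain.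

Theorem theorem3p3 (R : realType) (n : nat) (M : manifold R n)
    (J : jacobi_structure M) (a : Cinfty M) (a_gt0 : forall x : M, 0 < a x)
    (k : int) :
  exists f : {linear lj_cohomology J k -> lj_cohomology (conformal J a) k},
    bijective f.
Proof.
have a_neq0 x : a x != 0 by rewrite gt_eqF.
exact: (quot_linear_iso (@conformal_cocycleK _ _ _ J a a_neq0 k)
  (@conformal_cocycle_invK _ _ _ J a a_neq0 k)
  (@conformal_cocycle_coboundary _ _ _ J a a_neq0 k)).
Qed.
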